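(* Suppose FRA-Poly Phase 2 is run on the output $(\mathcal{F},s')$, $\mathcal{F}\neq\emptyset$, of FRA-Poly Phase 1 applied to (D). Then the output face of Phase 2 is $\mathcal{F}_{\min}^D$, and there exists $\hat s$ as in Steps 3 and 4 of Phase 2, i.e. there is a convex combination $\hat s$ of $\tilde s$ and $s'$ such that $\hat s\in\mathrm{ri}\,\mathcal{F}_{\min}^D$.
   Context: Let $\mathcal{K}=\mathcal{K}^1\times\cdots\times\mathcal{K}^r\subseteq\mathbb{R}^n$ be a product of closed convex cones, $\mathcal{A}:\mathbb{R}^n\to\mathbb{R}^m$ linear with adjoint $\mathcal{A}^*$, $b\in\mathbb{R}^m$, $c\in\mathbb{R}^n$; a star on a cone denotes the dual cone. Problem (D) is $\sup\{\langle b,y\rangle : c-\mathcal{A}^*y\in\mathcal{K}\}$; $\mathcal{F}_{\min}^D$ is the minimal face of $\mathcal{K}$ containing the feasible slacks $\{c-\mathcal{A}^*y\in\mathcal{K}\}$ (empty if (D) is infeasible). Every face $\mathcal{F}$ of $\mathcal{K}$ is written $\mathcal{F}=\mathcal{F}^1\times\cdots\times\mathcal{F}^r$ with $\mathcal{F}^j$ a face of $\mathcal{K}^j$, and vectors are split into blocks accordingly. For a closed convex cone $\mathcal{C}\subseteq\mathbb{R}^n$ and $e,e^*\in\mathbb{R}^n$, consider the pair $(P_{\mathcal{C}})$: minimize $t$ over $(x,t,w)\in\mathcal{C}^*\times\mathbb{R}_+\times\mathbb{R}_+$ subject to $-\langle c,x-te^*\rangle+t-w=0$, $\langle e,x\rangle+w=1$,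 $\mathcal{A}x-t\mathcal{A}e^*=0$; $(D_{\mathcal{C}})$: maximize $y_2$ over $(y_1,y_2,y_3)\in\mathbb{R}\times\mathbb{R}\times\mathbb{R}^m$ subject to $cy_1-ey_2-\mathcal{A}^*y_3\in\mathcal{C}$, $1-y_1(1+\langle c,e^*\rangle)+\langle e^*,\mathcal{A}^*y_3\rangle\ge0$, $y_1-y_2\ge0$. Optimal solutions $(x^*,t^*,w^* )$, $(y_1^*,y_2^*,y_3^* )$ of this pair (with equal optimal values) are strictly complementary if $cy_1^*-ey_2^*-\mathcal{A}^*y_3^*\in\mathrm{ri}(\mathcal{C}\cap\{x^*\}^\perp)$, $t^*+1-y_1^*(1+\langle c,e^*\rangle)+\langle e^*,\mathcal{A}^*y_3^*\rangle>0$, and $w^*+y_1^*-y_2^*>0$. FRA-Poly Phase 1: Step 1. $\mathcal{F}_1\leftarrow\mathcal{K}$, $i\leftarrow1$. Step 2. Let $(x^*,t^*,w^* )$ and $(y_1^*,y_2^*,y_3^* )$ be any pair of optimal solutions to $(P_{\mathcal{F}_i})$ and $(D_{\mathcal{F}_i})$, with any $e^*\in\mathrm{ri}\,\mathcal{F}_i^*$ and any $e$ such that $e_j=0$ if $\mathcal{F}_i^j$ is polyhedral and $e_j\in\mathrm{ri}\,\mathcal{F}_i^j$ otherwise. Step 3. If $t^*=0$ and $\langle c,x^*\rangle<0$, let $\mathcal{F}_{\min}^D\leftarrow\emptyset$ and stop ((D) is infeasible). Step 4. If $t^*=0$ and $\langle c,x^*\rangle=0$, let $d_i\leftarrow x^*$,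 $\mathcal{F}_{i+1}\leftarrow\mathcal{F}_i\cap\{d_i\}^\perp$, $i\leftarrow i+1$ and return to Step 2. Step 5. If $t^*>0$, let $s'\leftarrow c-\mathcal{A}^*\frac{y_3^*}{y_1^*}$, $\mathcal{F}\leftarrow\mathcal{F}_i$ and stop. FRA-Poly Phase 2 (input: (D) and the output $\mathcal{F}\ne\emptyset$, $s'$ of Phase 1): Step 1. Let $\hat{\mathcal{K}}=\hat{\mathcal{K}}^1\times\cdots\times\hat{\mathcal{K}}^r$, where $\hat{\mathcal{K}}^j=\mathcal{F}^j$ if $\mathcal{F}^j$ is polyhedral and $\hat{\mathcal{K}}^j=\mathrm{span}\,\mathcal{F}^j$ otherwise. Step 2. Let $(x^*,t^*,w^* )$ and $(y_1^*,y_2^*,y_3^* )$ be any pair of strictly complementary optimal solutions to $(P_{\hat{\mathcal{K}}})$ and $(D_{\hat{\mathcal{K}}})$ with any $e\in\mathrm{ri}\,\hat{\mathcal{K}}$ and any $e^*\in\mathrm{ri}\,\hat{\mathcal{K}}^*$. Step 3. If $t^*=0$, output the face $\mathcal{F}\cap\{x^*\}^\perp$; let $\tilde s=c-\mathcal{A}^*\frac{y_3^*}{y_1^*}$ and let $\hat s$ be a convex combination of $\tilde s$ and $s'$ such that $\hat s\in\mathrm{ri}\,\mathcal{F}_{\min}^D$; stop. Step 4. If $t^*>0$, output the face $\mathcal{F}$; let $\tilde s=c-\mathcal{A}^*\frac{y_3^*}{y_1^*}$ and let $\hat s$ be a convex combination of $\tilde s$ and $s'$ such that $\hat s\in\mathrm{ri}\,\mathcal{F}_{\min}^D$;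 stop. *)

(* Defs.v *)
From mathcomp Require Import all_boot all_order all_algebra.
From mathcomp Require Import all_classical all_reals all_analysis.

Set Implicit Arguments.
Unset Strict Implicit.
Unset Printing Implicit Defensive.

Import Order.TTheory GRing.Theory Num.Theory.
Import numFieldNormedType.Exports.

Local Open Scope classical_set_scope.
Local Open Scope ring_scope.

Definition dot (R : realType) (n : nat) (x y : 'cV[R]_n) : R := (x^T *m y) 0 0.

Section ConvexGeometry.
Context {R : realType} {n : nat}.
Implicit Types (C F L S : set 'cV[R]_n) (x y e : 'cV[R]_n).

(* set0 is a convex cone in this sense, hence also a face of every set. *)
Definition convex_cone C :=
  convex_set C /\ forall (a : R) x, 0 <= a -> C x -> C (a *: x).

Definition closed_convex_cone C :=
  [/\ C !=set0, closed C & convex_cone C].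

Definition face C F :=
  [/\ convex_cone F, F `<=` C &
      forall x y, C x -> C y -> F (x + y) -> F x /\ F y].

Definition dual_cone C := [set y | forall x, C x -> 0 <= dot x y].

Definition orth x := [set y | dot x y = 0].

Definition affine_set L :=
  forall (a : R) x y, L x -> L y -> L (a *: x + (1 - a) *: y).

Definition affine_hull S := smallest affine_set S.

Definition ri S :=
  [set x | S x /\ \forall y \near x, affine_hull S y -> S y].

Definition linear_subspace L :=
  L 0 /\ forall (a : R) x y, L x -> L y -> L (a *: x + y).

Definition lin_span S := smallest linear_subspace S.

Definition polyhedral S :=
  exists (k : nat) (B : 'M[R]_(k, n)) (d : 'cV[R]_k),
    S = [set x | forall i, (B *m x) i 0 <= d i 0].

End ConvexGeometry.

Section AuxiliaryPair.
Context {R : realType} {m n : nat}.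
Variables (A : 'M[R]_(m, n)) (c : 'cV[R]_n).
Implicit Types (C K : set 'cV[R]_n) (e es x : 'cV[R]_n).

Definition slacks K :=
  [set s | K s /\ exists y : 'cV[R]_m, s = c - A^T *m y].

Definition FminD K := smallest (face K) (slacks K).

Lemma face_FminD K : convex_cone K -> face K (FminD K).
Proof.
move=> [cK sK]; have fK : [set M | face K M /\ slacks K `<=` M] K.
  split=> [|s []//]; split=> // x y Kx Ky _; by split.
split; last 2 first.
- by move=> x; apply.
- move=> x y Kx Ky Fxy; split=> M [fM sM];
    by have [_ _ /(_ x y Kx Ky (Fxy M (conj fM sM)))[]] := fM.
split=> [x y l|a x a0 Fx M hM]; last by have [[[_ ]]] := hM; move=> + _ _ _; apply => //; exact: Fx.
rewrite !inE => Fx Fy M hM.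
have [[[cM _] _ _] _] := hM.
by have := cM x y l; rewrite !inE; apply; [exact: Fx|exact: Fy].
Qed.

Lemma FminD_infeasible K : slacks K = set0 -> FminD K = set0.
Proof.
move=> K0; rewrite -subset0 => x; apply; split; last by rewrite K0.
split=> //; split=> // y z l; by rewrite inE.
Qed.

Definition feasP C e es x (t w : R) :=
  [/\ dual_cone C x, 0 <= t & 0 <= w] /\
  [/\ - dot c (x - t *: es) + t - w = 0,
      dot e x + w = 1 &
      A *m x - t *: (A *m es) = 0].

Definition optP C e es x t w :=
  feasP C e es x t w /\
  forall x' t' w', feasP C e es x' t' w' -> t <= t'.

Definition feasD C e es (y1 y2 : R) y3 :=
  [/\ C (y1 *: c - y2 *: e - A^T *m y3),
      0 <= 1 - y1 * (1 + dot c es) + dot es (A^T *m y3) &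
      0 <= y1 - y2].

Definition optD C e es y1 y2 y3 :=
  feasD C e es y1 y2 y3 /\
  forall y1' y2' y3', feasD C e es y1' y2' y3' -> y2' <= y2.

Definition strictly_complementary C e es x t w y1 y2 y3 :=
  [/\ optP C e es x t w, optD C e es y1 y2 y3 & t = y2] /\
  [/\ ri (C `&` orth x) (y1 *: c - y2 *: e - A^T *m y3),
      0 < t + 1 - y1 * (1 + dot c es) + dot es (A^T *m y3) &
      0 < w + y1 - y2].

End AuxiliaryPair.

Section FRAPoly.
Context {R : realType} {m r : nat} {p : 'I_r -> nat}.
Local Notation n := (\sum_(j < r) p j)%N.

Definition prod_set (K : forall j, set 'cV[R]_(p j)) : set 'cV[R]_n :=
  [set x | forall j, K j (submxcol x j)].

(* The factor F^j of a nonempty product F = F^1 x ... x F^r; face_prod_block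
   shows that every nonempty face of a product is such a product. *)
Definition block (F : set 'cV[R]_n) (j : 'I_r) : set 'cV[R]_(p j) :=
  [set submxcol x j | x in F].
Arguments block : clear implicits.

Lemma face_prod_block (K : forall j, set 'cV[R]_(p j)) (F : set 'cV[R]_n) :
  (forall j, closed_convex_cone (K j)) ->
  face (prod_set K) F -> F !=set0 ->
  F = prod_set (block F) /\ forall j, face (K j) (block F j).
Proof.
move=> hK [[cF sF] FK fF] [x0 Fx0].
have F0 : F 0 by rewrite -(scale0r x0); exact: sF.
have K0 j : K j 0.
  have [[x Kx] _ [_ s0]] := hK j.
  by rewrite -(scale0r x); exact: s0.
have FD x y : F x -> F y -> F (x + y).
  have h1 : 2^-1 <= 1 :> R by rewrite invf_le1 ?ler1n.
  have h0 : 0 <= 2^-1 :> R by rewrite invr_ge0.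
  move=> Fx Fy; have := cF x y (Itv01 h0 h1).
  rewrite !inE => /(_ Fx Fy) /(sF 2 _ (ler0n _ _)).
  suff -> : 2 *: (2^-1 *: x + (1 - 2^-1) *: y) = x + y by [].
  by rewrite scalerDr !scalerA mulrBr mulr1 divff// -[2 - 1]addrA subrr addr0 !scale1r.
pose emb j (u : 'cV[R]_(p j)) : 'cV[R]_n :=
  \mxcol_i dfwith (fun i => 0 : 'cV[R]_(p i)) j u i.
have embE j u : submxcol (emb j u) j = u by rewrite mxcolK dfwithin.
have emb0 j i u : j != i -> submxcol (emb j u) i = 0.
  by move=> ij; rewrite mxcolK dfwithout.
have Kemb j u : K j u -> prod_set K (emb j u).
  move=> Ku i; have [<-|ji] := eqVneq j i; first by rewrite embE.
  by rewrite emb0.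
have Femb j y : F y -> F (emb j (submxcol y j)).
  move=> Fy; have Ky := FK _ Fy.
  have Kd : prod_set K (y - emb j (submxcol y j)).
    move=> i; rewrite submxcolB; have [<-|ji] := eqVneq j i.
      by rewrite embE subrr.
    by rewrite emb0// subr0.
  have yE : F (emb j (submxcol y j) + (y - emb j (submxcol y j))).
    by rewrite addrC subrK.
  exact: (fF _ _ (Kemb _ _ (Ky j)) Kd yE).1.
split=> [|j].
  apply/seteqP; split=> [x Fx j|x hx]; first by exists x.
  have {hx} /choice[y hy] : forall j, exists y, F y /\ submxcol y j = submxcol x j.
    by move=> j; have [y] := hx j; exists y.
  have -> : x = \sum_j emb j (submxcol (y j) j).
    apply/mxcolP => i; rewrite submxcol_sum (bigD1 i)//= embE big1 ?addr0.
      by rewrite (hy i).2.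
    by move=> j ji; rewrite emb0.
  by elim/big_ind : _ => // j _; apply: Femb; exact: (hy j).1.
split.
- split=> [u v l|a _ a0 [y Fy <-]].
    rewrite !inE => -[y Fy <-] -[y' Fy' <-].
    exists (l%:num *: y + (1 - l%:num) *: y').
      by have := cF y y' l; rewrite !inE; exact.
    by rewrite submxcolD; congr (_ + _); apply/matrixP => k k'; rewrite !mxE.
  exists (a *: y); first exact: sF.
  by apply/matrixP => k k'; rewrite !mxE.
- by move=> _ [y Fy <-]; exact: FK.
- move=> u v Ku Kv [y Fy yuv].
  have Fuv : F (emb j u + emb j v).
    have -> : emb j u + emb j v = emb j (submxcol y j); last exact: Femb.
    apply/mxcolP => i; rewrite submxcolD yuv.
    have [<-|ji] := eqVneq j i; first by rewrite !embE.
    by rewrite !emb0// addr0.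
  have [Fu Fv] := fF _ _ (Kemb _ _ Ku) (Kemb _ _ Kv) Fuv.
  by split; [exists (emb j u)|exists (emb j v)].
Qed.

Variables (A : 'M[R]_(m, n)) (c : 'cV[R]_n).
Implicit Types (F : set 'cV[R]_n) (e es x : 'cV[R]_n).

Definition partial_ri F e :=
  forall j, (polyhedral (block F j) -> submxcol e j = 0) /\
            (~ polyhedral (block F j) -> ri (block F j) (submxcol e j)).

Definition phase1_step2 F x t w y1 y2 y3 :=
  exists e es, [/\ partial_ri F e, ri (dual_cone F) es,
    optP A c F e es x t w & optD A c F e es y1 y2 y3].

(* The inductive predicate phase1_from F out describes the terminating runs
   that reach Step 2 with current face F.
   The result None is the exit with FminD <- set0; Some (F, s') is the
   exit with a nonempty face. *)
Inductive phase1_from F : option (set 'cV[R]_n * 'cV[R]_n) -> Prop :=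
| Phase1Step3 x t w y1 y2 y3 of
    phase1_step2 F x t w y1 y2 y3 & t = 0 & dot c x < 0 :
    phase1_from F None
| Phase1Step4 x t w y1 y2 y3 out of
    phase1_step2 F x t w y1 y2 y3 & t = 0 & dot c x = 0 &
    phase1_from (F `&` orth x) out :
    phase1_from F out
| Phase1Step5 x t w y1 y2 y3 of
    phase1_step2 F x t w y1 y2 y3 & 0 < t :
    phase1_from F (Some (F, c - A^T *m (y1^-1 *: y3))).

Definition phase1 (K : forall j, set 'cV[R]_(p j)) := phase1_from (prod_set K).

Definition Khat F : set 'cV[R]_n :=
  prod_set (fun j =>
    if `[< polyhedral (block F j) >] then block F j
    else lin_span (block F j)).

Definition phase2_step2 F x t w y1 y2 y3 :=
  exists e es, [/\ ri (Khat F) e, ri (dual_cone (Khat F)) es &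
    strictly_complementary A c (Khat F) e es x t w y1 y2 y3].

(* phase2 F G st: a run of Phase 2 on F outputs the face G and computes st,
   the slack \tilde s. *)
Inductive phase2 F : set 'cV[R]_n -> 'cV[R]_n -> Prop :=
| Phase2Step3 x t w y1 y2 y3 of
    phase2_step2 F x t w y1 y2 y3 & t = 0 :
    phase2 F (F `&` orth x) (c - A^T *m (y1^-1 *: y3))
| Phase2Step4 x t w y1 y2 y3 of
    phase2_step2 F x t w y1 y2 y3 & 0 < t :
    phase2 F F (c - A^T *m (y1^-1 *: y3)).

End FRAPoly.

Arguments block {R r p} F j.

(* Main.v *)
(* Phase 1 stops with a positive optimal value, and (es, 1, 1) is a Slater point
   of the primal problem, so strong duality makes y2 positive.  Hence s' is a
   slack of (D) that can be perturbed within F in every direction of Khat F: its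
   non-polyhedral blocks are relative interior, because e enters them with
   positive weight.  In Phase 2, every slack of (D) lies in the output face G
   and st is relative interior to the relaxation of G obtained from Khat F.
   Moving from s' slightly towards st therefore gives a slack in ri G, and a
   face that contains all slacks and has one in its relative interior is
   minimal.
   The relative interior of a convex cone has an algebraic description
   (cone_core), so that strong duality and the bipolar theorem both follow from
   the M. Riesz extension theorem. *)
Require Import Defs.
From mathcomp Require Import all_boot all_order all_algebra.
From mathcomp Require Import all_classical all_reals all_analysis.
From mathcomp Require Import ring lra.
Import Order.TTheory GRing.Theory Num.Theory.
Import numFieldNormedType.Exports.

Local Open Scope classical_set_scope.
Local Open Scope ring_scope.

(** * Bilinearity of the inner product and adjoints *)

Section Dot.
Context {R : realType} {n : nat}.
Implicit Types (x y z : 'cV[R]_n) (a : R).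

Lemma dotE x y : dot x y = \sum_i x i 0 * y i 0.
Proof. by rewrite /dot mxE; apply: eq_bigr => i _; rewrite mxE. Qed.

Lemma dotC x y : dot x y = dot y x.
Proof. by rewrite !dotE; apply: eq_bigr => i _; rewrite mulrC. Qed.

Lemma dotDr x y z : dot x (y + z) = dot x y + dot x z.
Proof. by rewrite /dot mulmxDr mxE. Qed.

Lemma dotZr a x y : dot x (a *: y) = a * dot x y.
Proof. by rewrite /dot -scalemxAr mxE. Qed.

Lemma dotNr x y : dot x (- y) = - dot x y.
Proof. by rewrite -scaleN1r dotZr mulN1r. Qed.

Lemma dot0r x : dot x 0 = 0.
Proof. by rewrite -(scale0r 0) dotZr mul0r. Qed.

Lemma dotDl x y z : dot (x + y) z = dot x z + dot y z.
Proof. by rewrite dotC dotDr !(dotC z). Qed.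

Lemma dotZl a x y : dot (a *: x) y = a * dot x y.
Proof. by rewrite dotC dotZr dotC. Qed.

Lemma dotNl x y : dot (- x) y = - dot x y.
Proof. by rewrite dotC dotNr dotC. Qed.

Lemma dot0l x : dot 0 x = 0.
Proof. by rewrite dotC dot0r. Qed.

End Dot.

Definition dot_linE := (@dotDl, @dotDr, @dotNl, @dotNr, @dotZl, @dotZr, @dot0l, @dot0r).

Lemma dot_trmxl (R : realType) m n (A : 'M[R]_(m, n)) (x : 'cV[R]_m)
  (y : 'cV[R]_n) : dot (A^T *m x) y = dot x (A *m y).
Proof. by rewrite /dot trmx_mul trmxK mulmxA. Qed.

Lemma dot_trmxr (R : realType) m n (A : 'M[R]_(m, n)) (x : 'cV[R]_n)
  (y : 'cV[R]_m) : dot x (A^T *m y) = dot (A *m x) y.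
Proof. by rewrite dotC dot_trmxl dotC. Qed.

(** * Convex cones, dual cones and orthogonal complements *)

Section Cones.
Context {R : realType} {n : nat}.
Implicit Types (C S : set 'cV[R]_n) (x y z : 'cV[R]_n) (a : R).

Lemma convex_coneZ C a x : convex_cone C -> 0 <= a -> C x -> C (a *: x).
Proof. by move=> [_]; exact. Qed.

Lemma convex_cone_conv {C} a x y : convex_set C -> 0 <= a -> a <= 1 ->
  C x -> C y -> C (a *: x + (1 - a) *: y).
Proof.
by move=> cC a0 a1 Cx Cy; have := cC x y (Itv01 a0 a1); rewrite !inE; exact.
Qed.

Lemma convex_coneD {C} x y : convex_cone C -> C x -> C y -> C (x + y).
Proof.
move=> cC Cx Cy.
have -> : x + y = 2 *: (2^-1 *: x + (1 - 2^-1) *: y).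
  rewrite scalerDr !scalerA mulrBr mulr1 divff// scale1r.
  by rewrite -[2 - 1]addrA subrr addr0 scale1r.
apply: convex_coneZ => //; apply: convex_cone_conv => //; first exact: cC.1.
by rewrite invf_le1 ?ler1n.
Qed.

Lemma convex_coneP C :
  (forall x y, C x -> C y -> C (x + y)) ->
  (forall a x, 0 <= a -> C x -> C (a *: x)) -> convex_cone C.
Proof.
move=> CD CZ; split=> // x y l; rewrite !inE => Cx Cy.
by apply: CD; apply: CZ => //; rewrite ?subr_ge0.
Qed.

Lemma convex_cone0 C x : convex_cone C -> C x -> C 0.
Proof. by move=> cC Cx; rewrite -(scale0r x); exact: convex_coneZ. Qed.

Lemma dual_cone_cone C : convex_cone (dual_cone C).
Proof.
apply: convex_coneP => [x y hx hy z Cz|a x a0 hx z Cz].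
  by rewrite dotDr addr_ge0 ?hx ?hy.
by rewrite dotZr mulr_ge0 ?hx.
Qed.

Lemma orth_cone x : convex_cone (orth x).
Proof.
apply: convex_coneP => [y z|a y a0]; rewrite /orth/= => hy.
  by rewrite dotDr hy => ->; rewrite addr0.
by rewrite dotZr hy mulr0.
Qed.

Lemma setI_cone C S : convex_cone C -> convex_cone S -> convex_cone (C `&` S).
Proof.
move=> cC cS; apply: convex_coneP => [x y [Cx Sx] [Cy Sy]|a x a0 [Cx Sx]].
  by split; apply: convex_coneD.
by split; apply: convex_coneZ.
Qed.

End Cones.

(** * Extension of positive functionals and Farkas' lemma *)

Section Riesz.
Context {R : realType} {n : nat}.
Implicit Types (V : set 'cV[R]_n) (f u v : 'cV[R]_n).

(** One-dimensional step: the value of [g] at [v] must be at least every element of [E] and at most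
    [dot f u] whenever [V (u - v)]. Positivity of [f] makes these demands compatible, so [sup E]
    serves. *)
Lemma riesz_step V (U : 'M[R]_n) f v : convex_cone V ->
  (forall u, (u^T <= U)%MS -> V u -> 0 <= dot f u) ->
  V v -> ~~ (v^T <= U)%MS -> (exists2 u, (u^T <= U)%MS & V (u - v)) ->
  exists2 g, forall u, (u^T <= U)%MS -> dot g u = dot f u
    & forall u, (u^T <= U + v^T)%MS -> V u -> 0 <= dot g u.
Proof.
move=> cV fV Vv vU [u0 u0U Vu0].
pose E := [set - dot f u | u in [set u | (u^T <= U)%MS /\ V (u + v)]].
have E0 : E !=set0.
  by exists (- dot f 0), 0 => //=; rewrite trmx0 sub0mx add0r.
have ubE u : (u^T <= U)%MS -> V (u - v) -> ubound E (dot f u).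
  move=> uU Vuv _ [w [wU Vwv] <-]; rewrite -subr_ge0 opprK -dotDr.
  apply: fV; first by rewrite linearD addmx_sub.
  by have := convex_coneD _ _ cV Vuv Vwv; rewrite addrACA addNr addr0.
(* Some column of the cokernel of [U] does not annihilate [v]; normalized, it allows the value at
   [v] to be changed without affecting [U]. *)
have [h hU hv] : exists2 h, forall u, (u^T <= U)%MS -> dot h u = 0 & dot h v = 1.
  move: vU; rewrite submxE => /matrix0Pn[i [j]]; rewrite ord1 => hj.
  pose h := col j (cokermx U).
  have dotU u : dot h u = (u^T *m cokermx U) 0 j.
    by rewrite dotC /dot /h colE mulmxA -colE mxE.
  exists ((dot h v)^-1 *: h) => [u|]; last by rewrite dotZl mulVf // dotU.
  by rewrite submxE dotZl (dotU u) => /eqP ->; rewrite mxE mulr0.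
exists (f + (sup E - dot f v) *: h) => [u uU|_u].
  by rewrite dotDl dotZl hU// mulr0 addr0.
case/sub_addsmxP => -[a b]/=; set u := (a *m U)^T.
rewrite [b]mx11_scalar mul_scalar_mx; move: (b 0 0) => {}b.
have uU : (u^T <= U)%MS by rewrite trmxK submxMl.
move=> /(congr1 trmx); rewrite trmxK => ->; rewrite linearD linearZ/= trmxK -/u.
move=> Vu; rewrite !dot_linE hU// hv add0r mulr1.
have -> : dot f u + b * dot f v + (sup E - dot f v) * b = dot f u + b * sup E.
  by ring.
have scU k : ((k *: u)^T <= U)%MS by rewrite linearZ/= scalemx_sub.
(* Division by the absolute value of [b] reduces to [u + v], an element of [E], or to [u - v], an
   upper bound of [E]. *)
have [b0|b0|b0] := ltgtP b 0; last 2 first.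
- rewrite -(@pmulr_rge0 _ b^-1) ?invr_gt0// mulrDr mulKf ?gt_eqF//.
  rewrite addrC -lerBlDr sub0r; apply: ub_le_sup.
    by exists (dot f u0); exact: ubE.
  exists (b^-1 *: u); last by rewrite dotZr.
  split=> //; have := convex_coneZ _ b^-1 _ cV _ Vu.
  by rewrite scalerDr scalerA mulVf ?gt_eqF// scale1r; apply; rewrite invr_ge0 ltW.
- by move: Vu; rewrite b0 scale0r addr0 mul0r addr0; exact: fV.
- rewrite -(@pmulr_rge0 _ (- b)^-1) ?invr_gt0 ?oppr_gt0//.
  rewrite mulrDr invrN !mulNr mulKf ?lt_eqF// subr_ge0; apply: ge_sup => //.
  rewrite -mulNr -dotZr; apply: ubE => //.
  have := convex_coneZ _ (- b^-1) _ cV _ Vu.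
  rewrite scalerDr scalerA mulNr mulVf ?lt_eqF// scaleN1r; apply.
  by rewrite oppr_ge0 invr_le0 ltW.
Qed.

(* M. Riesz extension theorem; the subspace is the row space of U. *)
Lemma riesz_extension V (U : 'M[R]_n) f : convex_cone V ->
  (forall v, V v -> exists2 u, (u^T <= U)%MS & V (u - v)) ->
  (forall u, (u^T <= U)%MS -> V u -> 0 <= dot f u) ->
  exists2 g, forall u, (u^T <= U)%MS -> dot g u = dot f u
    & forall v, V v -> 0 <= dot g v.
Proof.
(* Induction on the codimension of [U], which drops when an element of [V] outside [U] is
   adjoined. *)
move=> cV; have [k] := ubnP (n - \rank U).
elim: k U f => // k IH U f; rewrite ltnS => rU absU fV.
have [VU|] := pselect (forall v, V v -> (v^T <= U)%MS).
  by exists f => // v Vv; apply: fV => //; exact: VU.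
move=> /existsNP[v /not_implyP[Vv /negP vU]].
have [g gf gV] := riesz_step _ _ _ _ cV fV Vv vU (absU _ Vv).
have [|w Vw|u uU Vu|g' g'g g'V] := IH (U + v^T)%MS g.
- apply: leq_trans rU; rewrite ltn_sub2l//; last first.
    apply: rank_ltmx; rewrite ltmxE addsmxSl/=; apply: contra vU.
    exact: submx_trans (addsmxSr _ _).
  rewrite ltn_neqAle rank_leq_col andbT; apply: contra vU => /eqP rUn.
  by apply: submx_full; rewrite /row_full rUn.
- have [u uU Vuw] := absU _ Vw; exists u => //.
  exact: submx_trans uU (addsmxSl _ _).
- exact: gV.
exists g' => // u uU; rewrite -gf// g'g//.
exact: submx_trans uU (addsmxSl _ _).
Qed.

(* Farkas' lemma under Slater's condition: [z0] is a relative interior point of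
   the cone [V] that satisfies the constraints. *)
Lemma slater_farkas k V (B : 'M[R]_(k, n)) f z0 : convex_cone V ->
  B *m z0 = 0 -> (forall v, V v -> exists a, V (a *: z0 - v)) ->
  (forall v, V v -> B *m v = 0 -> 0 <= dot f v) ->
  exists u : 'cV_k, forall v, V v -> 0 <= dot (f + B^T *m u) v.
Proof.
move=> cV Bz0 z0V fV.
have kerP v : (v^T <= kermx B^T)%MS <-> B *m v = 0.
  split=> [/sub_kermxP|Bv]; last by apply/sub_kermxP; rewrite -trmx_mul Bv trmx0.
  by rewrite -trmx_mul => /(congr1 trmx); rewrite trmxK trmx0.
have [v Vv|u /kerP Bu Vu|g gf gV] := riesz_extension _ (kermx B^T) f cV.
- have [a Va] := z0V _ Vv; exists (a *: z0) => //; apply/kerP.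
  by rewrite -scalemxAr Bz0 scaler0.
- exact: fV.
(* [g] and [f] agree on the kernel of [B], so [g - f] is a combination of the rows of [B]; its
   coefficients are the multipliers. *)
suff /submxP[D gD] : ((g - f)^T <= B)%MS.
  exists D^T => v Vv; rewrite -trmx_mul -gD trmxK addrC subrK; exact: gV.
rewrite submxE; apply/eqP/matrixP => i j; rewrite ord1 mxE [RHS]mxE.
have -> : \sum_j0 (g - f)^T 0 j0 * cokermx B j0 j = dot (g - f) (col j (cokermx B)).
  by rewrite dotE; apply: eq_bigr => l _; rewrite !mxE.
rewrite dotDl dotNl gf ?subrr//; apply/kerP.
by rewrite colE mulmxA mulmx_coker mul0mx.
Qed.

End Riesz.

(** * Bipolar theorem and the algebraic form of the relative interior *)

Section Topology.
Context {R : realType} {n : nat}.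
Implicit Types (C S : set 'cV[R]_n) (x y z : 'cV[R]_n).

Lemma nbhs_cVP x (P : set 'cV[R]_n) :
  nbhs x P <-> exists2 e : R, 0 < e & forall y, (forall i, `|x i 0 - y i 0| < e) -> P y.
Proof.
rewrite nbhs_ballP; split=> -[e/= e0 xP]; exists e => // y.
  by move=> xy; apply: xP; split=> // i j; rewrite ord1; exact: xy.
by case=> _ xy; apply: xP => i; exact: xy.
Qed.

Lemma le_sum_norm x i : `|x i 0| <= \sum_j `|x j 0|.
Proof. by rewrite (bigD1 i)//= lerDl sumr_ge0. Qed.

(* Extend the functional [z |-> -1] on the line through a point [z] outside [C]
   to one that is nonnegative on [C] minus the cone over a box around [z]. *)
Lemma bipolar C z : closed_convex_cone C ->
  (forall x, dual_cone C x -> 0 <= dot x z) -> C z.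
Proof.
move=> [[c0 Cc0] clC cC] hz; apply: contrapT => nCz.
have C0 := convex_cone0 _ _ cC Cc0.
have [e e0 zC] : exists2 e : R, 0 < e &
    forall y, (forall i, `|z i 0 - y i 0| < e) -> ~ C y.
  apply/nbhs_cVP; apply: open_nbhs_nbhs; split; last by [].
  exact: closed_openC.
have zz : 0 < dot z z.
  rewrite dotE; have /matrix0Pn[i [j]] : z != 0.
    by apply/eqP => z0; apply: nCz; rewrite z0.
  rewrite ord1 => zi; rewrite (bigD1 i)//= ltr_pwDl//.
    by rewrite -expr2 exprn_even_gt0.
  by apply: sumr_ge0 => ? _; rewrite -expr2 sqr_ge0.
pose V := [set v | exists a, exists2 d : 'cV[R]_n,
  0 <= a /\ forall i, `|d i 0| <= a * (e / 2) & C (v + a *: z + d)].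
have cV : convex_cone V.
  apply: convex_coneP => [v w [a [d [a0 da] Cd]] [b [d' [b0 db] Cd']]|].
    exists (a + b), (d + d').
      split=> [|i]; first exact: addr_ge0.
      by rewrite mxE mulrDl (le_trans (ler_normD _ _))// lerD.
    have := convex_coneD _ _ cC Cd Cd'; congr C.
    by rewrite scalerDl addrACA; congr (_ + _); rewrite addrACA.
  move=> k v k0 [a [d [a0 da] Cd]]; exists (k * a), (k *: d).
    split=> [|i]; first exact: mulr_ge0.
    by rewrite mxE normrM ger0_norm// -mulrA ler_wpM2l.
  by have := convex_coneZ _ k _ cC k0 Cd; rewrite !scalerDr scalerA.
pose f := - (dot z z)^-1 *: z.
have fz a : dot f (a *: z) = - a.
  by rewrite !dot_linE; field; rewrite gt_eqF.
have lineP u : (u^T <= <<z^T>>)%MS -> exists a, u = a *: z.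
  rewrite genmxE => /submxP[D]; rewrite [D]mx11_scalar mul_scalar_mx.
  by move=> /(congr1 trmx); rewrite linearZ/= !trmxK => ->; exists (D 0 0).
have lineZ a : ((a *: z)^T <= <<z^T>>)%MS.
  by rewrite genmxE linearZ/= scalemx_sub.
have [v _|_ /lineP[a ->]|g gf gV] := riesz_extension _ (<<z^T>>%MS) f cV.
(* With [d = v] the point tested for membership in [C] is 0, so [a] only has to be large enough for
   [v] to fit into the box. *)
- pose a := (\sum_i `|v i 0|) / (e / 2).
  have a0 : 0 <= a by rewrite divr_ge0 ?sumr_ge0// divr_ge0// ltW.
  exists (- a *: z) => //; exists a, v; last first.
    by rewrite addrAC subrK scaleNr addNr.
  split=> // i; rewrite divfK ?gt_eqF ?divr_gt0//; exact: le_sum_norm.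
(* If [a] were positive, division by [a + b] would give a point of [C] in the box around [z]. *)
- rewrite fz oppr_ge0 => -[b [d [b0 db]]]; rewrite -scalerDl => Cd.
  rewrite leNgt; apply/negP => a0; have ab : 0 < a + b by rewrite ltr_pwDl.
  apply: (zC (z + (a + b)^-1 *: d)) => [i|].
    rewrite !mxE opprD addrA subrr add0r normrN normrM gtr0_norm ?invr_gt0//.
    rewrite mulrC ltr_pdivrMr// (le_lt_trans (db i))//.
    by nra.
  have := convex_coneZ _ (a + b)^-1 _ cC _ Cd.
  by rewrite scalerDr scalerA mulVf ?gt_eqF// scale1r; apply; rewrite invr_ge0 ltW.
(* [C] is contained in [V], so [g] lies in the dual cone, although its value at [z] is -1. *)
have /hz : dual_cone C g.
  move=> x Cx; rewrite dotC; apply: gV; exists 0, 0.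
    by split=> // i; rewrite mxE normr0 mul0r.
  by rewrite scale0r !addr0.
by rewrite -[z]scale1r gf// fz ler0N1.
Qed.

(** For convex cones this is equivalent to [ri], by [ri_core] and [core_ri]; homogeneity allows
    subtracting [e *: y] instead of prolonging the segment from [y] through [x]. *)
Definition cone_core S x := S x /\ forall y, S y -> exists2 e : R, 0 < e & S (x - e *: y).

Lemma ri_core C x : convex_cone C -> ri C x -> cone_core C x.
Proof.
move=> cC [Cx /nbhs_cVP[e e0 xC]]; split=> // y Cy.
(* Small enough for the point [x + d *: (x - y)] of the affine hull to stay within distance [e] of
   [x]; the summand 1 keeps the denominator positive. *)
pose d := e / (2 * (1 + \sum_i `|(x - y) i 0|)).
have s0 : 0 <= \sum_i `|(x - y) i 0| by apply: sumr_ge0.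
have d0 : 0 < d by rewrite divr_gt0// mulr_gt0// ltr_pwDl.
have Cd : C ((1 + d) *: x + (1 - (1 + d)) *: y).
  apply: xC => [i|]; last first.
    by move=> L [affL CL]; apply: affL; exact: CL.
  rewrite !mxE; have -> : x i 0 - ((1 + d) * x i 0 + (1 - (1 + d)) * y i 0) =
     - d * (x - y) i 0 by rewrite !mxE; ring.
  rewrite normrM normrN (gtr0_norm d0).
  apply: (@le_lt_trans _ _ (d * \sum_i `|(x - y) i 0|)).
    by rewrite ler_pM2l ?le_sum_norm.
  by rewrite /d -mulrA gtr_pMr// ltr_pdivrMl ?mulr_gt0 ?ltr_pwDl//; lra.
have d1 : 0 < 1 + d by rewrite addr_gt0.
exists (d / (1 + d)); first by rewrite divr_gt0.
have := convex_coneZ _ (1 + d)^-1 _ cC _ Cd; rewrite invr_ge0 (ltW d1) => /(_ isT).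
rewrite scalerDr !scalerA mulVf ?gt_eqF// scale1r -scaleNr; congr (C (_ + _ *: _)).
by field; rewrite gt_eqF.
Qed.

(** Adjoining an element of [S] outside the row space raises the rank, which is at most [n], so the
    process ends. *)
Lemma row_basis S : exists k (U : 'M[R]_(k, n)),
  (forall i, S (row i U)^T) /\ forall x, S x -> (x^T <= U)%MS.
Proof.
suff H N : forall k (U : 'M[R]_(k, n)), (n - \rank U < N)%N ->
    (forall i, S (row i U)^T) -> exists k' (U' : 'M[R]_(k', n)),
    (forall i, S (row i U')^T) /\ forall x, S x -> (x^T <= U')%MS.
  by apply: (H n.+1 0%N 0) => [|[]//]; rewrite ltnS leq_subr.
elim: N => // N IH k U; rewrite ltnS => rU SU.
have [|] := pselect (forall v, S v -> (v^T <= U)%MS); first by exists k, U.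
move=> /existsNP[v /not_implyP[Sv /negP vU]].
apply: (IH _ (col_mx U v^T)) => [|i]; last first.
  rewrite -(splitK i); case: (fintype.split i) => j/=.
    by rewrite rowKu.
  by rewrite rowKd row_id trmxK.
have lt : (U < U + v^T)%MS.
  rewrite ltmxE addsmxSl/=; apply: contra vU.
  exact: submx_trans (addsmxSr _ _).
apply: leq_trans rU; rewrite -addsmxE ltn_sub2l ?rank_ltmx//.
by apply: leq_trans (rank_ltmx lt) (rank_leq_col _).
Qed.


Lemma uniform_pos k (P : 'I_k -> R -> Prop) :
  (forall i, exists2 e : R, 0 < e & P i e) ->
  (forall i e d, 0 < d -> d <= e -> P i e -> P i d) ->
  exists2 e : R, 0 < e & forall i, P i e.
Proof.
move=> Pe Pmon; have /choice[e he] : forall i, exists e : R, 0 < e /\ P i e.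
  by move=> i; have [e] := Pe i; exists e.
(* The default value 1 takes care of [k = 0]. *)
have d0 : 0 < \big[Num.min/1]_i e i.
  by apply: lt_bigmin => [|i _]; [exact: ltr01|exact: (he i).1].
exists (\big[Num.min/1]_i e i) => // i.
by apply: (Pmon _ (e i)) => //; [exact: bigmin_le_cond|exact: (he i).2].
Qed.

Lemma cone_shrink C x y (e d : R) : convex_cone C -> C x -> 0 < d -> d <= e ->
  C (x + e *: y) -> C (x + d *: y).
Proof.
move=> cC Cx d0 de Cxe; have e0 := lt_le_trans d0 de.
have := convex_cone_conv (d / e) _ _ cC.1 _ _ Cxe Cx.
have -> : d / e *: (x + e *: y) + (1 - d / e) *: x = x + d *: y.
  rewrite scalerDr scalerBl scale1r scalerA divfK ?gt_eqF//.
  by rewrite addrC addrA subrK.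
by apply; [rewrite divr_ge0// ltW | rewrite ler_pdivrMr// mul1r].
Qed.

(** [x] can be moved both ways along each of finitely many elements of [C] that span it; a nearby
    point of the affine hull is an average of such displaced points. *)
Lemma core_ri C x : convex_cone C -> cone_core C x -> ri C x.
Proof.
move=> cC [Cx coreC]; split=> //.
have C0 := convex_cone0 _ _ cC Cx.
have [k [U [CU UC]]] := row_basis C.
have hullU y : affine_hull C y -> (y^T <= U)%MS.
  apply: (@smallest_sub _ affine_set C [set y | (y^T <= U)%MS]) => //.
  by move=> a u v /= uU vU; rewrite linearD !linearZ/= addmx_sub// scalemx_sub.
have [e e0 Ce] : exists2 e : R, 0 < e & forall i, C (x - e *: (row i U)^T).
  apply: (@uniform_pos _ (fun i e => C (x - e *: (row i U)^T))).
    by move=> i; exact: coreC.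
  by move=> i e d d0 de; rewrite -!scalerN; exact: cone_shrink.
have CU' i b : `|b| <= e -> C (x + b *: (row i U)^T).
  move=> be; have [b0|b0|->] := ltgtP b 0; last by rewrite scale0r addr0.
    rewrite -[b]opprK scaleNr -scalerN; apply: (cone_shrink _ _ _ e) => //.
    - by rewrite oppr_gt0.
    - by rewrite -ltr0_norm.
    - by rewrite scalerN; exact: Ce.
  by apply: convex_coneD => //; apply: convex_coneZ (CU i) => //; exact: ltW.
(* [M] bounds the coordinates of [y - x] in the rows of [U] in terms of its entries; [K] counts the
   [k + 1] terms of the average. *)
pose M := \sum_i \sum_j `|pinvmx U j i|.
have M0 : 0 <= M by apply: sumr_ge0 => i _; apply: sumr_ge0.
pose K : R := k.+1%:R; have K0 : 0 < K by rewrite ltr0n.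
apply/nbhs_cVP; exists (e / (K * (1 + M))).
  by rewrite divr_gt0// mulr_gt0// ltr_pwDl.
move=> y xy /hullU yU.
have /mulmxKpV : ((y - x)^T <= U)%MS.
  by rewrite linearB addmx_sub// ?(eqmx_opp) ?UC.
set c := _ *m pinvmx U => cU.
have yE : y = x + \sum_i c 0 i *: (row i U)^T.
  rewrite -[LHS](subrK x) addrC; congr (_ + _); apply: trmx_inj.
  rewrite -cU mulmx_sum_row linear_sum/=; apply: eq_bigr => i _.
  by rewrite linearZ/= trmxK.
have cb i : `|K * c 0 i| <= e.
  rewrite normrM gtr0_norm// -ler_pdivlMl//.
  apply: (@le_trans _ _ (\sum_j e / (K * (1 + M)) * `|pinvmx U j i|)).
    rewrite mxE (le_trans (ler_norm_sum _ _ _))//; apply: ler_sum => j _.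
    rewrite normrM ler_wpM2r// !mxE distrC; exact/ltW/xy.
  rewrite -mulr_sumr.
  apply: (@le_trans _ _ (e / (K * (1 + M)) * M)).
    rewrite ler_wpM2l//; first by rewrite divr_ge0 ?ltW// mulr_gt0// ltr_pwDl.
    by rewrite /M (bigD1 i)//= lerDl sumr_ge0// => ? _; apply: sumr_ge0.
  have -> : e / (K * (1 + M)) * M = K^-1 * e * (M / (1 + M)).
    by field; rewrite !gt_eqF// ltr_pwDl.
  apply: ler_piMr; first by rewrite mulr_ge0 ?invr_ge0 ?ltW.
  by rewrite ler_pdivrMr ?ltr_pwDl// mul1r lerDr.
have -> : y = K^-1 *: x + \sum_i K^-1 *: (x + (K * c 0 i) *: (row i U)^T).
  rewrite yE -scaler_sumr big_split/= sumr_const card_ord scalerDr addrA.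
  congr (_ + _); last first.
    rewrite scaler_sumr; apply: eq_bigr => i _.
    by rewrite scalerA mulKf// gt_eqF.
  rewrite -scalerDr -mulrS -scaler_nat scalerA mulVf ?scale1r// gt_eqF//.
have CK z : C z -> C (K^-1 *: z).
  by apply: convex_coneZ => //; rewrite invr_ge0 ltW.
apply: convex_coneD => //; first exact: CK.
elim/big_ind : _ => [//|u v|i _]; first exact: convex_coneD.
by apply: CK; exact: CU'.
Qed.

End Topology.

(** * Operations on relative interior points and linear spans of cones *)

Section Core.
Context {R : realType} {n : nat}.
Implicit Types (C G H : set 'cV[R]_n) (x y : 'cV[R]_n).

Lemma core_addr C x y : convex_cone C -> cone_core C x -> C y -> cone_core C (x + y).
Proof.
move=> cC [Cx coreC] Cy; split=> [|z Cz]; first exact: convex_coneD.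
have [e e0 Ce] := coreC _ Cz; exists e => //.
by rewrite addrAC; exact: convex_coneD.
Qed.

Lemma core_scale C (a : R) x : convex_cone C -> 0 < a -> cone_core C x ->
  cone_core C (a *: x).
Proof.
move=> cC a0 [Cx coreC]; split=> [|z Cz]; first by apply: convex_coneZ => //; exact: ltW.
have [e e0 Ce] := coreC _ Cz; exists (a * e); first exact: mulr_gt0.
by rewrite -scalerA -scalerBr; apply: convex_coneZ Ce => //; exact: ltW.
Qed.

(** For [y] in [G] the direction [t - e1 *: y] is still in [H] for some positive [e1], and [G]
    absorbs it at [s]. The point [t] itself may lie outside [G]. *)
Lemma core_segment G H (s t : 'cV[R]_n) : convex_cone G -> G `<=` H -> G s ->
  (forall h, H h -> exists2 e : R, 0 < e & G (s + e *: h)) -> cone_core H t ->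
  exists a : R, [/\ 0 <= a, a <= 1 & cone_core G (a *: t + (1 - a) *: s)].
Proof.
move=> cG GH Gs absG [Ht coreH]; have [e e0 Ge] := absG _ Ht.
pose b := e / 2; have b0 : 0 < b by rewrite divr_gt0.
have be : b < e by rewrite /b; lra.
have b1 : 0 < 1 + b by rewrite addr_gt0.
exists (b / (1 + b)); split; first by rewrite divr_ge0 ?ltW.
  by rewrite ler_pdivrMr// mul1r lerDr.
have -> : b / (1 + b) *: t + (1 - b / (1 + b)) *: s = (1 + b)^-1 *: (s + b *: t).
  rewrite scalerDr scalerA addrC; congr (_ *: _ + _ *: _); last by rewrite mulrC.
  by field; rewrite gt_eqF.
apply: core_scale => //; first by rewrite invr_gt0.
split; first exact: cone_shrink (ltW be) Ge.
move=> y Gy; have [e1 e10 He1] := coreH _ (GH _ Gy).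
have [e2 e20 Ge2] := absG _ He1.
pose d := Num.min e2 b; have d0 : 0 < d by rewrite lt_min e20.
have db : d <= b by rewrite ge_min lexx orbT.
have de2 : d <= e2 by rewrite ge_min lexx.
have G1 := cone_shrink _ _ _ _ _ cG Gs d0 de2 Ge2.
have G2 : G (s + (e - d) *: t).
  by apply: (cone_shrink _ _ _ e) => //; rewrite ?subr_gt0 ?gerBl ?ltW// (le_lt_trans db).
exists (d * e1 / 2); first by rewrite divr_gt0// mulr_gt0.
(* Since [b = e / 2], the point [s + b *: t] is the midpoint of [s + d *: t] and [s + (e - d) *: t],
   and the former has room in direction [- y]. *)
have -> : s + b *: t - (d * e1 / 2) *: y =
    2^-1 *: (s + d *: (t - e1 *: y) + (s + (e - d) *: t)).
  by apply/matrixP => i j; rewrite !mxE /b; field.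
by apply: convex_coneZ => //; exact: convex_coneD.
Qed.

Lemma lin_span_cone C : convex_cone (lin_span C).
Proof.
apply: convex_coneP => [x y hx hy L hL|a x _ hx L hL]; have [[L0 LD] CL] := hL.
  by rewrite -[x]scale1r; apply: LD; [exact: hx|exact: hy].
by rewrite -[_ *: _]addr0; apply: LD => //; exact: hx.
Qed.

(** The differences of elements of a convex cone form a linear subspace; a negative scalar swaps the
    two terms. *)
Lemma lin_span_diff C x : convex_cone C -> C 0 -> lin_span C x ->
  exists y z, [/\ C y, C z & x = y - z].
Proof.
move=> cC C0.
apply: (@smallest_sub _ linear_subspace C
  [set x | exists y z, [/\ C y, C z & x = y - z]]); last first.
  by move=> y Cy; exists y, 0; split=> //; rewrite subr0.
split; first by exists 0, 0; split=> //; rewrite subr0.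
move=> a _ _ [y [z [Cy Cz ->]]] [y' [z' [Cy' Cz' ->]]].
have [a0|a0] := leP 0 a.
  exists (a *: y + y'), (a *: z + z'); split.
  - by apply: convex_coneD => //; exact: convex_coneZ.
  - by apply: convex_coneD => //; exact: convex_coneZ.
  - by rewrite scalerBr opprD addrACA.
have na : 0 <= - a by rewrite oppr_ge0 ltW.
exists (- a *: z + y'), (- a *: y + z'); split.
- by apply: convex_coneD => //; exact: convex_coneZ.
- by apply: convex_coneD => //; exact: convex_coneZ.
- by apply/matrixP => i j; rewrite !mxE; ring.
Qed.

(** In [k = y - z] with [y] and [z] in [C], only [z] has to be absorbed by the relative interior
    point. *)
Lemma core_span_absorb C x k : convex_cone C -> cone_core C x -> lin_span C k ->
  exists2 e : R, 0 < e & C (x + e *: k).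
Proof.
move=> cC [Cx coreC] /(lin_span_diff _ _ cC (convex_cone0 _ _ cC Cx)).
move=> [y [z [Cy Cz ->]]]; have [e e0 Ce] := coreC _ Cz; exists e => //.
rewrite scalerBr addrCA; apply: convex_coneD => //.
by apply: convex_coneZ => //; exact: ltW.
Qed.

End Core.

(** * Strong duality for the auxiliary pair *)

Lemma dot_col_mx (R : realType) n1 n2 (x x' : 'cV[R]_n1) (y y' : 'cV[R]_n2) :
  dot (col_mx x y) (col_mx x' y') = dot x x' + dot y y'.
Proof. by rewrite /dot tr_col_mx mul_row_col mxE. Qed.

Lemma dot_scalar_mx (R : realType) (a b : R) : dot (a%:M : 'cV[R]_1) b%:M = a * b.
Proof. by rewrite dotE big_ord1 !mxE. Qed.

Section Duality.
Context {R : realType} {m n : nat}.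
Variables (C : set 'cV[R]_n) (A : 'M[R]_(m, n)) (c e es : 'cV[R]_n).

Let pt (x : 'cV[R]_n) (t w : R) : 'cV[R]_(n + (1 + 1)) :=
  col_mx x (col_mx t%:M w%:M).

Let V := [set z | exists x (t w : R), [/\ dual_cone C x, 0 <= t, 0 <= w & z = pt x t w]].

(** Only the homogeneous equations of the primal problem; the normalization [dot e x + w = 1] enters
    through the functional [f] of [auxiliary_duality]. *)
Let B : 'M[R]_(1 + m, n + (1 + 1)) :=
  col_mx (row_mx (- c^T) (row_mx (1 + dot c es)%:M (-1)%:M))
         (row_mx A (row_mx (- (A *m es)) 0)).

Let ptD x t w x' t' w' : pt x t w + pt x' t' w' = pt (x + x') (t + t') (w + w').
Proof. by rewrite /pt !add_col_mx -!raddfD. Qed.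

Let ptZ a x t w : a *: pt x t w = pt (a *: x) (a * t) (a * w).
Proof. by rewrite /pt !scale_col_mx !scale_scalar_mx. Qed.

Let mulB x t w : B *m pt x t w =
  col_mx (- dot c (x - t *: es) + t - w)%:M (A *m x - t *: (A *m es)).
Proof.
rewrite /B /pt mul_col_mx !mul_row_col mul0mx addr0 mulNmx !mul_mx_scalar.
congr col_mx; last by rewrite scalerN.
apply/matrixP => i j; rewrite !ord1 2!mxE -/(dot c x) !mxE !dot_linE.
by rewrite eqxx !mulr1n; ring.
Qed.

Let cone_V : convex_cone V.
Proof.
have cC := dual_cone_cone C.
apply: convex_coneP.
  move=> _ _ [x [t [w [Cx t0 w0 ->]]]] [x' [t' [w' [Cx' t0' w0' ->]]]].
  exists (x + x'), (t + t'), (w + w'); rewrite ptD; split=> //.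
  - exact: (convex_coneD _ _ cC).
  - exact: addr_ge0.
  - exact: addr_ge0.
move=> a _ a0 [x [t [w [Cx t0 w0 ->]]]].
exists (a *: x), (a * t), (a * w); rewrite ptZ; split=> //.
- exact: (convex_coneZ _ _ _ cC).
- exact: mulr_ge0.
- exact: mulr_ge0.
Qed.

(* The homogenized constraints of (P_C) hold at [(es, 1, 1)], a Slater point. *)
Lemma auxiliary_duality x t w : closed_convex_cone C -> C e ->
  ri (dual_cone C) es -> optP A c C e es x t w ->
  exists y1 y3, feasD A c C e es y1 t y3.
Proof.
move=> clC Ce /(ri_core _ _ (dual_cone_cone C))[Ces coreC].
have cC := dual_cone_cone C.
move=> [[[Cx t0 w0] [E1 E2 E3]] topt].
pose f := col_mx (- t *: e) (col_mx 1%:M (- t)%:M).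
have fpt x' t' w' : dot f (pt x' t' w') = t' - t * (dot e x' + w').
  by rewrite /f /pt !dot_col_mx !dot_scalar_mx dotZl; ring.
have [||_ [x' [t' [w' [Cx' t0' w0' ->]]]]|u fV] :=
    slater_farkas _ V B f (pt es 1 1) cone_V.
- by rewrite mulB !scale1r !subrr dot0r oppr0 add0r subrr raddf0 col_mx0.
- move=> _ [x' [t' [w' [Cx' t0' w0' ->]]]].
  (* The share [d^-1] of the multiple absorbs [x'], the share [t' + w'] absorbs the two scalars. *)
  have [d d0 Cd] := coreC _ Cx'; exists (d^-1 + t' + w').
  have d0' : 0 <= d^-1 by rewrite invr_ge0 ltW.
  rewrite -scaleN1r !ptZ ptD; exists (d^-1 *: (es - d *: x') + (t' + w') *: es).
  exists (d^-1 + w'), (d^-1 + t'); split; try (exact: addr_ge0).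
    by apply: (convex_coneD _ _ cC); apply: (convex_coneZ _ _ _ cC) => //;
      exact: addr_ge0.
  congr pt; last 2 first; try (by ring).
  by apply/matrixP => i j; rewrite !mxE; field; rewrite gt_eqF.
- rewrite mulB fpt -[RHS](@col_mx0 _ 1 m 1) => /eq_col_mx[Es E3'].
  have E1' : - dot c (x' - t' *: es) + t' - w' = 0.
    by move/matrixP: Es => /(_ 0 0); rewrite !mxE eqxx.
  (* If this sum is 0, then [0 <= t'] suffices; otherwise dividing by it yields a primal feasible
     point, and optimality of [t] applies. *)
  have : 0 <= dot e x' + w' by rewrite addr_ge0// Cx'.
  rewrite le_eqVlt => /predU1P[<-|g0]; first by rewrite mulr0 subr0.
  set g := dot e x' + w' in g0 *.
  rewrite subr_ge0 -ler_pdivlMr//; apply: (topt (g^-1 *: x') _ (g^-1 * w')).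
  have gV : 0 <= g^-1 by rewrite invr_ge0 ltW.
  split; split.
  + exact: (convex_coneZ _ _ _ cC).
  + by rewrite divr_ge0// ltW.
  + exact: mulr_ge0.
  + rewrite -[RHS](mulr0 g^-1) -E1' !dot_linE; ring.
  + by rewrite dotZr -mulrDr -/g mulVf// gt_eqF.
  + by rewrite -scalemxAr mulrC -scalerA -scalerBr E3' scaler0.
have {}fV x' t' w' : dual_cone C x' -> 0 <= t' -> 0 <= w' ->
    0 <= t' - t * (dot e x' + w')
         + (u (lshift m 0) 0 * (- dot c (x' - t' *: es) + t' - w')
           + dot (dsubmx u) (A *m x' - t' *: (A *m es))).
  move=> Cx' t0' w0'; have : V (pt x' t' w') by exists x', t', w'.
  move=> /fV; rewrite dotDl fpt dot_trmxl mulB.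
  rewrite -{1}[u]vsubmxK dot_col_mx [usubmx u]mx11_scalar dot_scalar_mx.
  by rewrite mxE.
set u1 := u _ _ in fV; set u3 := dsubmx u in fV.
have Cd0 : dual_cone C 0 by move=> y _; rewrite dot0r.
(* Testing [fV] at [(y, 0, 0)], [(0, 1, 0)] and [(0, 0, 1)] gives the three dual constraints, the
   first by [bipolar]. *)
exists (- u1), (- u3); split.
- apply: bipolar => // y Cy; have := fV y 0 0 Cy (lexx _) (lexx _).
  rewrite !scale0r !subr0 !addr0 !dot_linE mulmxN dot_linE dot_trmxr.
  rewrite (dotC c) (dotC e) (dotC u3); congr (0 <= _); ring.
- have := fV 0 1 0 Cd0 ler01 (lexx _).
  rewrite !scale1r mulmx0 !dot_linE mulmxN dot_linE dot_trmxr (dotC u3).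
  by congr (0 <= _); ring.
- have := fV 0 0 1 Cd0 (lexx _) ler01.
  rewrite !scale0r mulmx0 subrr !dot_linE.
  by congr (0 <= _); ring.
Qed.

End Duality.

(** * Exposed faces, slacks and minimality *)

Section Faces.
Context {R : realType} {m n : nat}.
Implicit Types (C F G K : set 'cV[R]_n) (x y : 'cV[R]_n).

Lemma closed_orth x : closed (orth x).
Proof.
rewrite -openC openE => y /= /eqP xy.
have s0 : 0 <= \sum_i `|x i 0| by apply: sumr_ge0.
apply/nbhs_cVP; exists (`|dot x y| / (1 + \sum_i `|x i 0|)).
  by rewrite divr_gt0 ?normr_gt0 ?ltr_pwDl.
move=> z yz xz; rewrite /orth/= in xz.
have : `|dot x y| < `|dot x y|; last by rewrite ltxx.
rewrite -[in X in X < _](subr0 (dot x y)) -xz -dotNr -dotDr dotE.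
apply: (@le_lt_trans _ _ (\sum_i `|x i 0| * (`|dot x y| / (1 + \sum_i `|x i 0|)))).
  apply: (le_trans (ler_norm_sum _ _ _)); apply: ler_sum => i _.
  by rewrite normrM ler_wpM2l// !mxE; exact/ltW/yz.
rewrite -mulr_suml mulrCA gtr_pMr ?normr_gt0// ltr_pdivrMr ?ltr_pwDl//.
by rewrite mul1r ltrDr.
Qed.

Lemma dual_coneS C F : F `<=` C -> dual_cone C `<=` dual_cone F.
Proof. by move=> FC x hx y /FC; exact: hx. Qed.

(** Two nonnegative inner products with sum 0 both vanish. *)
Lemma face_orth K F x : face K F -> dual_cone F x -> face K (F `&` orth x).
Proof.
move=> [cF FK fF] hx; split.
- exact: setI_cone (orth_cone x).
- by move=> y [/FK].
- move=> y z Ky Kz [Fyz xyz]; have [Fy Fz] := fF _ _ Ky Kz Fyz.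
  have := hx _ Fy; have := hx _ Fz; rewrite ![dot _ x]dotC /orth/=.
  by move: xyz; rewrite /orth/= dotDr => xyz xz xy; split; split => //=; lra.
Qed.

Variables (A : 'M[R]_(m, n)) (c : 'cV[R]_n).

(** Exhibits the slack of (D) as a positive multiple of the auxiliary dual slack plus [y2 *: e], the
    source of its interiority. *)
Lemma slack_scale (y1 y2 : R) (y3 : 'cV[R]_m) (e : 'cV[R]_n) : 0 < y1 ->
  c - A^T *m (y1^-1 *: y3) =
  y1^-1 *: (y1 *: c - y2 *: e - A^T *m y3 + y2 *: e).
Proof.
move=> y10; rewrite -scalemxAr; move: (A^T *m y3) => z.
by apply/matrixP => i j; rewrite !mxE; field; rewrite gt_eqF.
Qed.

Lemma slacks_orth K F x : slacks A c K `<=` F -> A *m x = 0 -> dot c x = 0 ->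
  slacks A c K `<=` F `&` orth x.
Proof.
move=> sF Ax cx s Ks; split; first exact: sF.
have [_ [y ->]] := Ks.
by rewrite /orth/= dotDr dotNr dot_trmxr Ax dot0l dotC cx subr0.
Qed.

(** A face [M] with all slacks contains [s], which splits as [e *: g] plus [s - e *: g] inside [K];
    hence [M] contains [g]. *)
Lemma FminD_core K G s : face K G -> slacks A c K `<=` G -> cone_core G s ->
  (exists y : 'cV[R]_m, s = c - A^T *m y) -> G = FminD A c K.
Proof.
move=> fG sG [Gs coreG] sy; apply/seteqP; split; last exact: smallest_sub.
move=> g Gg M [fM sM]; have [cG GK _] := fG; have [cM _ ME] := fM.
have [e e0 Ge] := coreG _ Gg.
have Ms : M s by apply: sM; split=> //; exact: GK.
have Geg : G (e *: g) by apply: (convex_coneZ _ _ _ cG) => //; exact: ltW.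
have [] := ME (e *: g) (s - e *: g) (GK _ Geg) (GK _ Ge).
  by rewrite addrC subrK.
move=> Meg _; rewrite -[g]scale1r -(mulVf (negbT (gt_eqF e0))) -scalerA.
by apply: (convex_coneZ _ _ _ cM) => //; rewrite invr_ge0 ltW.
Qed.

(** Common conclusion of both exits of Phase 2, with [H] the relaxation of [G]; the point found by
    [core_segment] is of slack form as an affine combination of [s] and [t]. *)
Lemma FminD_segment K G H (y z : 'cV[R]_m) :
  let s := c - A^T *m y in let t := c - A^T *m z in
  face K G -> slacks A c K `<=` G -> G `<=` H -> G s ->
  (forall h, H h -> exists2 e : R, 0 < e & G (s + e *: h)) -> cone_core H t ->
  G = FminD A c K /\
  exists a : R, [/\ 0 <= a, a <= 1 & ri (FminD A c K) (a *: t + (1 - a) *: s)].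
Proof.
move=> s t fG sG GH Gs absG coreH; have [cG _ _] := fG.
have [a [a0 a1 core_a]] := core_segment _ _ _ _ cG GH Gs absG coreH.
have <- : G = FminD A c K.
  apply: (FminD_core _ _ _ fG sG core_a); exists (a *: z + (1 - a) *: y).
  rewrite mulmxDr -!scalemxAr /s /t.
  by apply/matrixP => i j; rewrite !mxE; ring.
by split=> //; exists a; split=> //; exact: core_ri.
Qed.

End Faces.

(** * Product cones, the relaxation [Khat] and the run of Phase 1 *)

Section Products.
Context {R : realType} {m r : nat} {p : 'I_r -> nat}.
Local Notation n := (\sum_(j < r) p j)%N.
Implicit Types (F G : set 'cV[R]_n) (K : forall j, set 'cV[R]_(p j)).

Lemma submxcolZ a (x : 'cV[R]_n) j : submxcol (a *: x) j = a *: submxcol x j.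
Proof. by apply/matrixP => k l; rewrite !mxE. Qed.

Lemma prod_set_cone K : (forall j, convex_cone (K j)) -> convex_cone (prod_set K).
Proof.
move=> cK; apply: convex_coneP => [x y Kx Ky j|a x a0 Kx j].
  by rewrite submxcolD; apply: (convex_coneD _ _ (cK j)).
by rewrite submxcolZ; apply: (convex_coneZ _ _ _ (cK j)).
Qed.

Lemma closed_prod_set K : (forall j, closed (K j)) -> closed (prod_set K).
Proof.
move=> clK; have -> : prod_set K = \bigcap_j ((fun x : 'cV[R]_n => submxcol x j) @^-1` K j).
  by apply/seteqP; split=> [x Kx j _|x Kx j]; [exact: Kx|exact: (Kx j I)].
apply: closed_bigI => j _; apply: preimage_closed => // x _ P /nbhs_cVP[e e0 xP].
apply/nbhs_cVP; exists e => // y xy; apply: xP => i.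
by rewrite !mxE; exact: xy.
Qed.

Lemma face_prod_set K : (forall j, closed_convex_cone (K j)) ->
  face (prod_set K) (prod_set K).
Proof. by move=> hK; split=> //; apply: prod_set_cone => j; have [] := hK j. Qed.

Variables (K : forall j, set 'cV[R]_(p j)) (A : 'M[R]_(m, n)) (c : 'cV[R]_n).
Hypothesis hK : forall j, closed_convex_cone (K j).

Section Face.
Variable F : set 'cV[R]_n.
Hypotheses (fF : face (prod_set K) F) (F0 : F 0).

Let F_neq0 : F !=set0. Proof. by exists 0. Qed.
Let FE : F = prod_set (block F) := (face_prod_block hK fF F_neq0).1.
Let block_cone j : convex_cone (block F j).
Proof. by have [] := (face_prod_block hK fF F_neq0).2 j. Qed.
Let block0 j : block F j 0.
Proof. by exists 0; rewrite ?submxcol0. Qed.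

Lemma partial_ri_sub e : partial_ri F e -> F e.
Proof.
move=> he; rewrite FE => j; have [poly npoly] := he j.
by have [/poly ->//|/npoly[]] := pselect (polyhedral (block F j)).
Qed.

Lemma Khat_cone : convex_cone (Khat F).
Proof.
by apply: prod_set_cone => j; case: ifP => _ //; exact: lin_span_cone.
Qed.

Lemma sub_Khat : F `<=` Khat F.
Proof.
rewrite {1}FE => x Fx j; case: ifP => _; first exact: Fx.
by apply: sub_gen_smallest; exact: Fx.
Qed.

(** On a polyhedral block [e] is 0 and [k] is already in the block; on any other block [e] is
    relative interior and absorbs the span. *)
Lemma Khat_absorb e k : partial_ri F e -> Khat F k ->
  exists2 d : R, 0 < d & F (e + d *: k).
Proof.
move=> he Kk; have Fe := partial_ri_sub _ he.
have Fej j : block F j (submxcol e j) by exists e.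
have [|i b d d0 db|d d0 Fd] :=
    @uniform_pos R r (fun j d => block F j (submxcol e j + d *: submxcol k j)).
- move=> j; have := Kk j; have [poly npoly] := he j.
  case: ifPn => [/asboolP Pj kj|/asboolP Pj kj].
    by exists 1 => //; rewrite poly// add0r scale1r.
  by apply: core_span_absorb => //; apply: ri_core => //; exact: npoly.
- exact: cone_shrink.
- by exists d => //; rewrite FE => j; rewrite submxcolD submxcolZ.
Qed.

End Face.

(** [F 0] rules out the empty face, and closedness is what [bipolar] asks for. *)
Definition phase1_inv F := [/\ face (prod_set K) F, F 0, closed F &
  slacks A c (prod_set K) `<=` F].

Lemma phase1_result F0 out : phase1_from A c F0 out -> phase1_inv F0 ->
  forall F s', out = Some (F, s') -> phase1_inv F /\
  exists (y1 y2 : R) (y3 : 'cV[R]_m) e, [/\ 0 < y1, 0 < y2, partial_ri F e,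
    F (y1 *: c - y2 *: e - A^T *m y3) & s' = c - A^T *m (y1^-1 *: y3)].
Proof.
elim=> {F0 out} [//|F x t w y1 y2 y3 out|F x t w y1 y2 y3].
  move=> [e [es [_ _ [[[Fx _ _] [_ _ Ax]] _] _]]] t0 cx _ IH [fF F0 clF sF].
  move: Ax; rewrite t0 scale0r subr0 => Ax; apply: IH; split.
  - exact: face_orth.
  - by split=> //; rewrite /orth/= dot0r.
  - by apply: closedI => //; exact: closed_orth.
  - exact: slacks_orth.
move=> [e [es [he hes hP hD]]] t0 [fF F0 clF sF] _ _ [<- <-]; split=> //.
have Fe := partial_ri_sub _ fF F0 _ he; have [cF _ _] := fF.
(* A dual feasible point with value [t] forces [y2] to be at least [t], and [y1] is at least
   [y2]. *)
have [y1' [y3' hD']] : exists y1 y3, feasD A c F e es y1 t y3.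
  by apply: auxiliary_duality hP => //; split=> //; exists 0.
have [[Fy _ y12] y2max] := hD; have ty2 := y2max _ _ _ hD'.
have y20 := lt_le_trans t0 ty2.
exists y1, y2, y3, e; split=> //.
by apply: lt_le_trans y20 _; rewrite -subr_ge0.
Qed.

Lemma result_absorb F (y1 y2 : R) (y3 : 'cV[R]_m) e : face (prod_set K) F -> F 0 ->
  0 < y1 -> 0 < y2 -> partial_ri F e -> F (y1 *: c - y2 *: e - A^T *m y3) ->
  forall k, Khat F k ->
  exists2 d : R, 0 < d & F (c - A^T *m (y1^-1 *: y3) + d *: k).
Proof.
move=> fF F0 y10 y20 he Fy k Kk; have [d d0 Fd] := Khat_absorb _ fF F0 _ _ he Kk.
have [cF _ _] := fF.
(* [e] has weight [y2 / y1] in the slack, so the step length [d] available at [e] is scaled by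
   it. *)
exists (y2 / y1 * d); first by rewrite mulr_gt0// divr_gt0.
rewrite (slack_scale _ _ _ y2 _ e)// mulrAC mulrC -scalerA -scalerDr -addrA.
rewrite -scalerA -scalerDr.
apply: (convex_coneZ _ _ _ cF); first by rewrite invr_ge0 ltW.
by apply: (convex_coneD _ _ cF) => //; apply: (convex_coneZ _ _ _ cF); rewrite ?ltW.
Qed.

End Products.

Theorem proposition9 (R : realType) (m r : nat) (p : 'I_r -> nat)
    (K : forall j : 'I_r, set 'cV[R]_(p j))
    (hK : forall j, closed_convex_cone (K j))
    (A : 'M[R]_(m, (\sum_(j < r) p j)%N))
    (b : 'cV[R]_m)
    (c : 'cV[R]_(\sum_(j < r) p j)%N)
    (F : set 'cV[R]_(\sum_(j < r) p j)%N)
    (s' : 'cV[R]_(\sum_(j < r) p j)%N)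
    (h1 : phase1 A c K (Some (F, s')))
    (G : set 'cV[R]_(\sum_(j < r) p j)%N)
    (st : 'cV[R]_(\sum_(j < r) p j)%N)
    (h2 : phase2 A c F G st) :
  G = FminD A c (prod_set K) /\
  exists a : R, [/\ 0 <= a, a <= 1 &
    ri (FminD A c (prod_set K)) (a *: st + (1 - a) *: s')].
Proof.
have inv0 : phase1_inv K A c (prod_set K).
  split; first exact: face_prod_set.
  - by move=> j; rewrite submxcol0; have [[x Kx] _ cKj] := hK j;
      apply: convex_cone0 Kx.
  - by apply: closed_prod_set => j; have [] := hK j.
  - by move=> s [].
have [[fF F0 clF sF] [z1 [z2 [z3 [e1 [z10 z20 he1 Fz s'E]]]]]] :=
  phase1_result _ _ _ hK _ _ h1 inv0 _ _ erefl.
have cF : convex_cone F by have [] := fF.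
have cH := Khat_cone _ hK _ fF F0.
have FH := sub_Khat _ hK _ fF F0.
have absF := result_absorb _ _ _ hK _ _ _ _ _ fF F0 z10 z20 he1 Fz.
rewrite -s'E in absF.
have Fs' : F s'.
  by have [d _] := absF 0 (FH _ F0); rewrite scaler0 addr0.
case: h2 => x t w y1 y2 y3 [e [es [re res [[optx opty ty2] [riy _ y1w]]]]] t0.
- have [[[Hx _ w0] [E1 E2 E3]] _] := optx.
  rewrite t0 !scale0r !subr0 addr0 in E1 E3.
  (* Since [A *m x = 0] and [s'] lies in [Khat F], [dot c x] is nonnegative; as [dot c x + w = 0],
     both terms vanish, and strict complementarity leaves [y1 > 0]. *)
  have cs' : dot c x = dot s' x by rewrite s'E dotDl dotNl dot_trmxl E3 dot0r subr0.
  have cx0 : 0 <= dot c x by rewrite cs'; apply: Hx; exact: FH.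
  have w0' : w = 0 by lra.
  have cx : dot c x = 0 by lra.
  have Fx := dual_coneS _ _ FH _ Hx.
  have y10 : 0 < y1 by lra.
  have xs' : orth x s' by rewrite /orth/= dotC -cs'.
  have cHx := setI_cone _ _ cH (orth_cone x).
  rewrite s'E; apply: (FminD_segment _ _ _ _ (Khat F `&` orth x)); rewrite -?s'E.
  + exact: face_orth.
  + exact: slacks_orth.
  + exact: setSI.
  + by [].
  + move=> h [Hh xh]; have [d d0 Fd] := absF _ Hh; exists d => //; split=> //.
    by rewrite /orth/= dotDr dotZr xs' xh mulr0 addr0.
  (* Because [y2 = 0], [st] is a positive multiple of the dual slack, which strict complementarity
     places in the relative interior. *)
  + rewrite (slack_scale _ _ _ y2 _ e)// -ty2 t0 scale0r addr0.
    apply: core_scale => //; first by rewrite invr_gt0.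
    by apply: ri_core => //; move: riy; rewrite -ty2 t0 scale0r.
- have [[Hy _ y12] _] := opty; have y20 : 0 < y2 by rewrite -ty2.
  have y10 : 0 < y1 by apply: lt_le_trans y20 _; rewrite -subr_ge0.
  rewrite s'E; apply: (FminD_segment _ _ _ _ (Khat F)); rewrite -?s'E //.
  (* Here [y2 > 0], and the summand [y2 *: e] makes [st] relative interior to [Khat F]. *)
  rewrite (slack_scale _ _ _ y2 _ e)// addrC; apply: core_scale; rewrite ?invr_gt0//.
  by apply: core_addr => //; apply: core_scale => //; exact: ri_core.
Qed.
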